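(* Let $n$ be a positive integer and consider two logical qubits (a control and a target), each encoded in $4n$ physical qubits with logical basis states $|0_L^{XT}\rangle=|\psi_0\rangle|\psi_1\rangle$ and $|1_L^{XT}\rangle=|\psi_1\rangle|\psi_0\rangle$ of the extended dual-rail encoding. For $1\le a,b,c\le 4n$ with $b\neq c$, let $C_{a,b,c}$ be the quantum Fredkin gate that swaps the $b$th and $c$th physical qubits of the target logical qubit if the $a$th physical qubit of the control logical qubit is $|1\rangle$, and acts as the identity if it is $|0\rangle$. Then applying $C_{n+i,\,j,\,n+j}$ for all $i,j=1,\dots,n$ and $C_{2n+i,\,2n+j,\,3n+j}$ for all $i,j=1,\dots,n$ implements the logical CNOT gate, i.e. it maps $$|a_L^{XT}\rangle\otimes|b_L^{XT}\rangle\mapsto|a_L^{XT}\rangle\otimes|(a+b \bmod 2)_L^{XT}\rangle,\qquad a,b\in\{0,1\}.$$ It uses $2n^2$ quantum Fredkin gates in total, and these can be arranged into $n$ timesteps.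
   Context: For $1\le j\le n$, $|(j)_n\rangle=X_j|0\rangle^{\otimes n}$ is the $n$-qubit computational basis state with a $|1\rangle$ in position $j$ and $|0\rangle$ elsewhere. With $x=e^{2\pi i/n}$, define the $2n$-qubit states $$|\psi_0\rangle=\frac1{\sqrt n}\sum_{j=1}^n x^{j-1}|(j)_n\rangle\otimes|0\rangle^{\otimes n},\qquad |\psi_1\rangle=|0\rangle^{\otimes n}\otimes\frac1{\sqrt n}\sum_{j=1}^n x^{j-1}|(j)_n\rangle .$$ The $4n$ physical qubits of a logical qubit are numbered $1,\dots,4n$ from left to right. A timestep is a collection of gates executed in parallel, i.e. acting on pairwise disjoint sets of physical qubits. *)

(* Defs.v *)
From HB Require Import structures.
From mathcomp Require Import all_boot all_order all_algebra.
From mathcomp Require Import perm complex.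
From mathcomp Require Import reals trigo.

Set Implicit Arguments.
Unset Strict Implicit.
Unset Printing Implicit Defensive.

Import GRing.Theory Num.Theory.
Local Open Scope ring_scope.
Local Open Scope complex_scope.

(* Qubits are numbered from left to right and from 0: the k-th qubit of an
   N-qubit register in the usual 1-based numbering is the ordinal k - 1. *)
Definition bits (N : nat) := {ffun 'I_N -> bool}.

(* The Hilbert space of N qubits: a vector is the family of its amplitudes in
   the computational basis.  The regular module R[i]^o makes it a vector space
   over the complex numbers R[i]. *)
Definition state (R : realType) (N : nat) := {ffun bits N -> (R[i])^o}.

Definition ket (R : realType) (N : nat) (s : bits N) : state R N :=
  [ffun t => (t == s)%:R].

Definition tensor (R : realType) (N1 N2 : nat)
    (u : state R N1) (v : state R N2) : state R (N1 + N2) :=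
  [ffun s : bits (N1 + N2) =>
     (u [ffun i => s (lshift N2 i)] : R[i]) * v [ffun i => s (rshift N1 i)]].

Definition ket0 (R : realType) (N : nat) : state R N :=
  ket R [ffun=> false].

Definition ket_one (R : realType) (N : nat) (j : 'I_N) : state R N :=
  ket R [ffun k => k == j].

(* e ^ (2 i pi / n) *)
Definition root_unity (R : realType) (n : nat) : R[i] :=
  cos (2 * pi / n%:R) +i* sin (2 * pi / n%:R).

(* As j starts from 0 here, the phase x ^ (j - 1) becomes x ^ j. *)
Definition wstate (R : realType) (n : nat) : state R n :=
  ((Num.sqrt (n%:R : R))^-1)%:C *:
    \sum_(j < n) root_unity R n ^+ j *: ket_one R j.

Definition psi0 (R : realType) (n : nat) : state R (n + n) :=
  tensor (wstate R n) (ket0 R n).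

Definition psi1 (R : realType) (n : nat) : state R (n + n) :=
  tensor (ket0 R n) (wstate R n).

(* The number 4n of physical qubits of a logical qubit, split in the way that
   makes the tensor products below well typed without casts. *)
Definition nphys (n : nat) : nat := (n + n) + (n + n).

Definition logical (R : realType) (n : nat) (b : bool) : state R (nphys n) :=
  if b then tensor (psi1 R n) (psi0 R n) else tensor (psi0 R n) (psi1 R n).

Definition cswap (N : nat) (p q r : 'I_N) (s : bits N) : bits N :=
  if s p then [ffun k => s (tperm q r k)] else s.

(* Linear extension of the action of cswap on the computational basis. *)
Definition fredkin (R : realType) (N : nat) (p q r : 'I_N)
    (u : state R N) : state R N :=
  \sum_(s : bits N) u s *: ket R (cswap p q r s).

(* The triple (a, b, c) stands for the gate C_{a,b,c}: a is a physical qubit of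
   the control logical qubit, b and c are physical qubits of the target. *)
Definition gate (n : nat) : finType :=
  ('I_(nphys n) * 'I_(nphys n) * 'I_(nphys n))%type.

(* The register of 8n physical qubits holds the control first, then the
   target. *)
Definition control_qubit (n : nat) (a : 'I_(nphys n)) :
  'I_(nphys n + nphys n) := lshift (nphys n) a.

Definition target_qubit (n : nat) (b : 'I_(nphys n)) :
  'I_(nphys n + nphys n) := rshift (nphys n) b.

Definition apply_gate (R : realType) (n : nat) (g : gate n) :
    state R (nphys n + nphys n) -> state R (nphys n + nphys n) :=
  let: (a, b, c) := g in
  fredkin (control_qubit a) (target_qubit b) (target_qubit c).

(* The head of the sequence is applied first. *)
Definition run (R : realType) (n : nat) (gs : seq (gate n))
    (u : state R (nphys n + nphys n)) : state R (nphys n + nphys n) :=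
  foldl (fun v g => apply_gate g v) u gs.

(* Physical qubits of the four blocks of n: for i : 'I_n, the ordinals
   blockK i have values i, n + i, 2n + i and 3n + i for K = 0, 1, 2, 3. *)
Definition block0 (n : nat) (i : 'I_n) : 'I_(nphys n) :=
  lshift (n + n) (lshift n i).
Definition block1 (n : nat) (i : 'I_n) : 'I_(nphys n) :=
  lshift (n + n) (rshift n i).
Definition block2 (n : nat) (i : 'I_n) : 'I_(nphys n) :=
  rshift (n + n) (lshift n i).
Definition block3 (n : nat) (i : 'I_n) : 'I_(nphys n) :=
  rshift (n + n) (rshift n i).

Definition cnot_gates (n : nat) : {set gate n} :=
  [set ((block1 i, block0 j, block1 j) : gate n) | i in 'I_n, j in 'I_n] :|:
  [set ((block2 i, block2 j, block3 j) : gate n) | i in 'I_n, j in 'I_n].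

Definition support (n : nat) (g : gate n) : {set 'I_(nphys n + nphys n)} :=
  let: (a, b, c) := g in
  [set control_qubit a; target_qubit b; target_qubit c].

Definition timestep (n : nat) (gs : seq (gate n)) : bool :=
  pairwise (fun g h => [disjoint support g & support h]) gs.

(* Main.v *)
Require Import Defs.
From mathcomp Require Import all_boot all_order all_algebra.
From mathcomp Require Import perm complex.
From mathcomp Require Import reals.

(** A Fredkin gate permutes the computational basis by an involution, so the
    amplitude at [t] after the circuit is the initial amplitude at the basis
    string obtained from [t] by undoing the gates.  On every basis string
    occurring in [logical R n a], each of the two control blocks used by the
    gates contains exactly [a] ones.  Each of the disjoint transpositions of
    the target therefore fires exactly [a] times, in whatever order the gates
    come; together they exchange the two blocks in each half of the target,
    which turns [logical R n b] into its negation.  For the depth, the [k]-th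
    timestep pairs the control [i] with the target [i + k] modulo [n]. *)

Set Implicit Arguments.
Unset Strict Implicit.
Unset Printing Implicit Defensive.

Import GRing.Theory Num.Theory.
Local Open Scope ring_scope.
Local Open Scope complex_scope.

(* [qubit h s j] is the [j]-th qubit of block number [2 h + s]. *)
Definition qubit (n : nat) (h s : bool) (j : 'I_n) : 'I_(nphys n) :=
  if h then (if s then block3 j else block2 j)
  else (if s then block1 j else block0 j).

Lemma eq_qubit (n : nat) (h h' s s' : bool) (j j' : 'I_n) :
  (qubit h s j == qubit h' s' j') = [&& h == h', s == s' & j == j'].
Proof. by case: h h' s s' => -[] [] []; rewrite /= !eq_shift. Qed.

Lemma qubit_inj (n : nat) (h h' s s' : bool) (j j' : 'I_n) :
  qubit h s j = qubit h' s' j' -> [/\ h = h', s = s' & j = j'].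
Proof. by move/eqP; rewrite eq_qubit => /and3P[/eqP-> /eqP-> /eqP->]. Qed.

(** Expressing the transposition as an xor on the block bit lets successive swaps accumulate as a
    parity. *)
Lemma tperm_qubit (n : nat) (h h' s : bool) (j j' : 'I_n) :
  tperm (qubit h' false j') (qubit h' true j') (qubit h s j) =
  qubit h (s (+) ((h == h') && (j == j'))) j.
Proof.
rewrite permE /= !eq_qubit.
case: (h =P h') => [->|_] /=; last by rewrite addbF.
case: (j =P j') => [->|_]; first by case: s.
by rewrite !andbF addbF.
Qed.

(** Labels turn the union of two gate families into one injective image of a product type. *)
Definition label (n : nat) : finType := (bool * 'I_n * 'I_n)%type.

Definition control (n : nat) (x : label n) : 'I_(nphys n) :=
  let: (h, i, _) := x in qubit h (~~ h) i.

Definition label_gate (n : nat) (x : label n) : gate n :=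
  let: (h, i, j) := x in (qubit h (~~ h) i, qubit h false j, qubit h true j).

Lemma label_gate_inj (n : nat) : injective (@label_gate n).
Proof.
by move=> [[h i] j] [[h' i'] j'] [] /qubit_inj[-> _ ->] /qubit_inj[_ _ ->].
Qed.

Lemma cnot_gatesE (n : nat) :
  cnot_gates n = [set label_gate x | x in [set: label n]].
Proof.
apply/setP => g; apply/idP/imsetP => [|[[[[] i] j] _ ->]] /=.
- rewrite inE => /orP[] /imset2P[i j _ _ ->];
    [exists (false, i, j) | exists (true, i, j)]; by rewrite ?inE.
- by rewrite inE; apply/orP; right; apply/imset2P; exists i j.
- by rewrite inE; apply/orP; left; apply/imset2P; exists i j.
Qed.

Lemma mem_cnot_gates (n : nat) (g : gate n) :
  (g \in cnot_gates n) = (g \in [seq label_gate x | x : label n]).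
Proof.
by rewrite cnot_gatesE; apply/imsetP/imageP => -[x _ ->]; exists x.
Qed.

Lemma perm_enum_cnot_gates (n : nat) :
  perm_eq (enum (cnot_gates n)) [seq label_gate x | x : label n].
Proof.
apply: uniq_perm; first exact: enum_uniq.
  by rewrite map_inj_uniq ?enum_uniq //; exact: label_gate_inj.
by move=> g; rewrite mem_enum mem_cnot_gates.
Qed.

Lemma card_cnot_gates (n : nat) : #|cnot_gates n| = (2 * n ^ 2)%N.
Proof.
rewrite cnot_gatesE card_imset; last exact: label_gate_inj.
by rewrite cardsT !card_prod card_bool card_ord mulnA.
Qed.

Lemma cswapK (N : nat) (p q r : 'I_N) :
  p != q -> p != r -> involutive (cswap p q r).
Proof.
move=> pq pr s; rewrite /cswap; case sp: (s p); last by rewrite sp.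
rewrite ffunE tpermD 1?eq_sym // sp.
by apply/ffunP => k; rewrite !ffunE tpermK.
Qed.

Lemma fredkinE (R : realType) (N : nat) (p q r : 'I_N) (u : state R N)
    (t : bits N) :
  p != q -> p != r -> fredkin p q r u t = u (cswap p q r t).
Proof.
move=> pq pr; rewrite /fredkin sum_ffunE (bigD1 (cswap p q r t)) //= big1.
  by rewrite !ffunE cswapK // eqxx addr0; exact: mulr1.
move=> s ns; rewrite !ffunE; case: eqP => [E|_]; last exact: mulr0.
by move: ns; rewrite E cswapK // eqxx.
Qed.

Definition gate_bits (n : nat) (g : gate n) :
    bits (nphys n + nphys n) -> bits (nphys n + nphys n) :=
  let: (a, b, c) := g in
  cswap (control_qubit a) (target_qubit b) (target_qubit c).

Lemma apply_gateE (R : realType) (n : nat) (g : gate n) u t :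
  apply_gate (R := R) g u t = u (gate_bits g t).
Proof. by case: g => [[a b] c]; rewrite /= fredkinE // eq_lrshift. Qed.

(** Amplitudes are pulled back, so the last gate is the first to act on [t]: the left fold becomes a
    right fold. *)
Lemma runE (R : realType) (n : nat) (gs : seq (gate n)) u t :
  run (R := R) gs u t = u (foldr (@gate_bits n) t gs).
Proof. by elim: gs u => //= g gs IH u; rewrite IH apply_gateE. Qed.

(** Controls may be read in the original [t], since every gate leaves the control register
    unchanged. *)
Definition fires (n : nat) (t : bits (nphys n + nphys n)) (h : bool) (j : 'I_n)
    (x : label n) : bool :=
  [&& t (control_qubit (control x)), h == x.1.1 & j == x.2].

(** Swaps of the same pair cancel two by two and the other swaps do not touch it, so only the parity
    of firings matters. *)
Lemma foldr_gate_bits (n : nat) (xs : seq (label n)) t :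
  let t' := foldr (@gate_bits n) t (map (@label_gate n) xs) in
  (forall k, t' (control_qubit k) = t (control_qubit k)) /\
  (forall h s j, t' (target_qubit (qubit h s j)) =
     t (target_qubit (qubit h (s (+) odd (count (fires t h j) xs)) j))).
Proof.
elim: xs => [|[[h' i'] j'] xs [IHc IHt]] /=.
  by split=> // h s j; rewrite addbF.
split=> [k|h s j]; rewrite /cswap; case: ifP => fire //.
- by rewrite ffunE tpermD ?eq_rlshift // IHc.
- rewrite IHc in fire.
  rewrite ffunE /target_qubit -(inj_tperm _ _ _ (@rshift_inj _ _)) tperm_qubit.
  by rewrite [LHS]IHt oddD oddb addbA /fires /= fire.
- by rewrite IHt /fires /= -IHc fire.
Qed.

Definition block (n : nat) (w : bits (nphys n)) (h s : bool) : bits n :=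
  [ffun j => w (qubit h s j)].

Lemma tensor4E (R : realType) (n : nat) (u0 u1 u2 u3 : state R n)
    (w : bits (nphys n)) :
  tensor (tensor u0 u1) (tensor u2 u3) w =
  ((u0 (block w false false) : R[i]) * u1 (block w false true)) *
  ((u2 (block w true false) : R[i]) * u3 (block w true true)).
Proof.
rewrite !ffunE; congr (u0 _ * u1 _ * (u2 _ * u3 _));
  by apply/ffunP => j; rewrite !ffunE.
Qed.

(** A single formula for both values of [b] shows that negating [b] amounts to exchanging the two
    blocks in each half. *)
Lemma logicalE (R : realType) (n : nat) (b : bool) (w : bits (nphys n)) :
  logical R n b w =
  ((wstate R n (block w false b) : R[i]) * ket0 R n (block w false (~~ b))) *
  ((ket0 R n (block w true b) : R[i]) * wstate R n (block w true (~~ b))).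
Proof.
case: b; rewrite /logical tensor4E //=.
by congr (_ * _); rewrite mulrC.
Qed.

Lemma logical_swap (R : realType) (n : nat) (a b : bool)
    (w w' : bits (nphys n)) :
  (forall h s j, w' (qubit h s j) = w (qubit h (s (+) a) j)) ->
  logical R n b w' = logical R n (a (+) b) w.
Proof.
move=> Ew; have E h s : block w' h s = block w h (a (+) s).
  by apply/ffunP => j; rewrite !ffunE Ew addbC.
by rewrite !logicalE !E addbN.
Qed.

Lemma ket0_neq0 (R : realType) (n : nat) (u : bits n) :
  ket0 R n u != 0 -> u = [ffun=> false].
Proof. by rewrite ffunE; case: (u =P _) => // _ /eqP. Qed.

Lemma wstate_neq0 (R : realType) (n : nat) (u : bits n) :
  wstate R n u != 0 -> exists i, u = [ffun k => k == i].
Proof.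
move=> nz; case: (pickP (fun i => u == [ffun k => k == i])) => [i /eqP|none].
  by exists i.
case/eqP: nz; rewrite ffunE sum_ffunE big1 ?scaler0 // => i _.
by rewrite !ffunE none scaler0.
Qed.

(* The blocks [2 h + ~~ h], namely 1 and 2, are those of the control qubits. *)
Lemma logical_neq0 (R : realType) (n : nat) (a : bool) (c : bits (nphys n)) :
  logical R n a c != 0 ->
  forall h, exists i0, forall i, c (qubit h (~~ h) i) = a && (i == i0).
Proof.
rewrite logicalE !mulf_eq0 !negb_or => /andP[/andP[w0 z0] /andP[z1 w1]] h.
have {w0} [i0 w0] := wstate_neq0 w0; have {w1} [i1 w1] := wstate_neq0 w1.
have {}z0 := ket0_neq0 z0; have {}z1 := ket0_neq0 z1.
have B s i : c (qubit h s i) = block c h s i by rewrite ffunE.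
(* [i0] and [i1] locate the single one of each half; it lies in the control block exactly when [a]
   holds. *)
exists (if h then i1 else i0) => i; rewrite B.
by case: h a {B} w0 z0 z1 w1 => -[] /= w0 z0 z1 w1;
  rewrite ?w0 ?z0 ?z1 ?w1 ffunE.
Qed.

(** For fixed [h] and [j] the control index runs once through a whole block, so [(h, i0, j)] is the
    only label that can fire, and it does so when [a] holds. *)
Lemma odd_count_fires (n : nat) (a h : bool) (i0 j : 'I_n)
    (t : bits (nphys n + nphys n)) (xs : seq (label n)) :
  perm_eq xs (enum (label n)) ->
  (forall i, t (control_qubit (qubit h (~~ h) i)) = a && (i == i0)) ->
  odd (count (fires t h j) xs) = a.
Proof.
move=> /seq.permP-> Ec.
rewrite (@eq_count _ _ (fun x => a && (x == (h, i0, j)))).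
  case: a {Ec} => /=; last by rewrite count_pred0.
  by rewrite (count_uniq_mem _ (enum_uniq _)) mem_enum.
move=> [[h' i] j']; rewrite /fires /= !xpair_eqE.
case: (h =P h') => [<-|ne]; last first.
  by rewrite andbF; case: eqP => [e|]; [case: ne|rewrite andbF].
by rewrite Ec eqxx /= andbA [j == _]eq_sym.
Qed.

Lemma run_cnot_gates (R : realType) (n : nat) (gs : seq (gate n)) (a b : bool) :
  perm_eq gs (enum (cnot_gates n)) ->
  run gs (tensor (logical R n a) (logical R n b)) =
  tensor (logical R n a) (logical R n (a (+) b)).
Proof.
move=> /perm_trans/(_ (perm_enum_cnot_gates n)) gsP.
have /subset_mapP[xs _ Egs] :
    {subset gs <= [seq label_gate x | x : label n]}.
  by move=> g; rewrite (perm_mem gsP).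
move: gsP; rewrite {}Egs => /(perm_map_inj (@label_gate_inj n)) xsP.
apply/ffunP => t; rewrite runE.
have [Ec Et] := foldr_gate_bits xs t; rewrite [LHS]ffunE [RHS]ffunE.
set c' := (X in logical R n a X * _ = _); set c := (X in _ = logical R n a X * _).
have -> : c' = c by apply/ffunP => k; rewrite !ffunE Ec.
(* Both sides share the control amplitude, so only strings where it is nonzero need the firing
   count. *)
have [->|/logical_neq0 cP] := eqVneq (logical R n a c) 0; first by rewrite !mul0r.
congr (_ * _); apply: logical_swap => h s j; rewrite !ffunE Et.
have [i0 i0P] := cP h; rewrite (@odd_count_fires _ a _ i0) // => i.
by rewrite -i0P ffunE.
Qed.

(** The successor gives ['I_n.+1] its cyclic addition. Both halves share a timestep because their
    gates use different blocks. *)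
Definition cnot_step (n : nat) (k : 'I_n.+1) : seq (gate n.+1) :=
  [seq label_gate ((x, x.2 + k) : label n.+1) |
     x <- enum {: bool * 'I_n.+1}].

Lemma timestep_cnot_step (n : nat) (k : 'I_n.+1) : timestep (cnot_step k).
Proof.
rewrite /timestep pairwise_map.
apply: (@sub_pairwise _ (fun x y => x != y)); last first.
  by rewrite -uniq_pairwise enum_uniq.
move=> [h i] [h' i'] ne /=.
rewrite disjoints_subset; apply/subsetP => q; rewrite !inE.
have ne' : (h == h') && (i == i') = false.
  by apply/negbTE; rewrite -xpair_eqE.
by case/orP=> [/orP[]|] /eqP->; rewrite ?eq_shift ?eq_qubit ?(inj_eq (addIr _));
   rewrite ?andbF //=; case: eqP ne' => //= _ ->; rewrite ?andbF.
Qed.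

Lemma perm_flatten_cnot_step (n : nat) :
  perm_eq (flatten [seq cnot_step k | k <- enum 'I_n.+1])
          (enum (cnot_gates n.+1)).
Proof.
apply: uniq_perm; [|exact: enum_uniq|].
  apply: allpairs_uniq; [exact: enum_uniq|exact: enum_uniq|].
  move=> [k [h i]] [k' [h' i']] _ _ /(@label_gate_inj _)/eqP.
  by rewrite !xpair_eqE => /andP[/andP[/eqP-> /eqP->]] /eqP/addrI->.
move=> g; rewrite mem_enum mem_cnot_gates.
apply/flatten_mapP/imageP => [[k _ /mapP[x _ ->]]|[[[h i] j] _ ->]].
  by exists (x, x.2 + k).
(* The gate from [i] to [j] belongs to the cyclic shift by [j - i]. *)
exists (j - i); first by rewrite mem_enum.
by apply/mapP; exists (h, i); rewrite ?mem_enum //= addrC subrK.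
Qed.

Theorem mainTheorem3 (R : realType) (n : nat) (n_gt0 : (0 < n)%N) :
  [/\ (* whatever the order in which the gates are applied *)
      forall gs : seq (gate n), perm_eq gs (enum (cnot_gates n)) ->
        forall a b : bool,
          run gs (tensor (logical R n a) (logical R n b)) =
          tensor (logical R n a) (logical R n (a (+) b)),
      #|cnot_gates n| = (2 * n ^ 2)%N
    & exists L : n.-tuple (seq (gate n)),
        perm_eq (flatten L) (enum (cnot_gates n)) /\ all (@timestep n) L].
Proof.
split=> [gs gsP a b||]; [exact: run_cnot_gates|exact: card_cnot_gates|].
case: n n_gt0 => // n _.
exists [tuple of [seq cnot_step k | k <- ord_tuple n.+1]]; split.
  by rewrite /= perm_flatten_cnot_step.
by apply/allP => gs /mapP[k _ ->]; exact: timestep_cnot_step.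
Qed.
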